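(* Let $G=(V,E)$ be a finite simple graph, let $F=\mathbb{R}$ or $F=\mathbb{C}$, let $S$ be a zero forcing set of $G$ with a forcing chain $S'$ and error polynomial vector $\mathbf{q}^{S'}(t)$, and let $\varepsilon>0$. Then for every $\mathbf{A}\in\mathcal{S}_F(G)$, writing $\kappa'=\kappa'(\mathbf{A})$, there is a map $\Phi_{\mathbf{A}}:F^S\to F^V$ (depending only on $\mathbf{A}$, $S$ and $S'$) such that for all $\mathbf{x}\in F^V$ with $\mathbf{A}\mathbf{x}=\mathbf{0}$ and all $\mathbf{x}'\in F^V$ with $\|\mathbf{x}-\mathbf{x}'\|_\infty<\varepsilon$, the vector $\hat{\mathbf{x}}:=\Phi_{\mathbf{A}}(\mathbf{x}'_S)$ satisfies $\hat{\mathbf{x}}_S=\mathbf{x}'_S$ and $|\mathbf{x}_i-\hat{\mathbf{x}}_i|\le\mathbf{q}^{S'}_i(\kappa')\,\varepsilon$ for every $i\in V$.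
   Context: Zero forcing: starting with the vertices of $S$ colored, if a colored vertex $u$ has exactly one uncolored neighbor $v$, then $u$ may force $v$ (color it); $S$ is a zero forcing set if repeated forcing colors all vertices. A forcing chain $S'$ of $S$ is a record of a valid forcing process from $S$ that colors all of $V$: a sequence of forces $u\to v$, each valid at the moment it is performed, in which every vertex of $V\setminus S$ is forced exactly once (equivalently, a collection of directed paths covering $V$, starting at the vertices of $S$, with $i\to j$ on a path only if $i$ forces $j$). $N[i]$ denotes the closed neighborhood of $i$ (including $i$). The error polynomial vector $\mathbf{q}^{S'}(t)$ is defined recursively: $\mathbf{q}^{S'}_k(t)=1$ if $k\in S$, and $\mathbf{q}^{S'}_k(t)=t\sum_{j\in N[i]\setminus\{k\}}\mathbf{q}^{S'}_j(t)$ if $i$ forces $k$ in $S'$. $\mathcal{S}_F(G)$ is the set of $|V|\times|V|$ matrices $\mathbf{A}$ over $F$ with, for $i\neq j$, $\mathbf{A}_{ij}=0$ if $\{i,j\}\notin E$ and $\mathbf{A}_{ij}\neq0$ if $\{i,j\}\in E$, diagonal arbitrary. $\kappa'(\mathbf{A})=\max_{i,j,k}|\mathbf{A}_{ij}/\mathbf{A}_{ik}|$ over triples with $\mathbf{A}_{ij},\mathbf{A}_{ik}\neq0$ (equal to $1$ for the zero matrix). $\mathbf{x}_S$ is the subvector of entries indexed by $S$. *)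

(* Defs.v *)
From HB Require Import structures.
From mathcomp Require Import all_boot all_order all_algebra.
From mathcomp Require Import complex.
From mathcomp Require Import reals matrix_normedtype.
Set Implicit Arguments.
Unset Strict Implicit.
Unset Printing Implicit Defensive.
Import Order.TTheory GRing.Theory Num.Theory.
Local Open Scope ring_scope.

(* A finite simple graph is a symmetric irreflexive [e : rel V] on a finType. *)

Section ZeroForcing.
Variables (V : finType) (e : rel V).
Implicit Types (C S : {set V}) (u v : V) (s : seq (V * V)).

Definition closed_nbhd u : {set V} := u |: [set w | e u w].

Definition can_force C u v : bool :=
  (u \in C) && ([set w | e u w & w \notin C] == [set v]).

(* [(u, v) \in s] stands for the force u -> v; the head of [s] is the force
   performed first, starting from the coloured set [C]. *)
Fixpoint valid_forces C s : bool :=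
  if s is (u, v) :: s' then can_force C u v && valid_forces (v |: C) s'
  else true.

Definition zero_forcing_set S : Prop :=
  exists s, valid_forces S s /\ S :|: [set v in unzip2 s] = [set: V].

Definition forcing_chain S s : Prop :=
  valid_forces S s /\ forall v, v \notin S -> count_mem v (unzip2 s) = 1%N.

(* The recursion q_k = t * \sum_(j in N[i] \ {k}) q_j is run along the forces in
   order; the value 0 given to vertices not yet reached is never used by a valid
   chain: see [error_poly_in] and [error_poly_force] for the defining
   equations. *)
Definition error_poly_step (F : nzRingType) (q : V -> {poly F}) (f : V * V) :
    V -> {poly F} :=
  fun w => if w == f.2 then 'X * \sum_(j in closed_nbhd f.1 :\ f.2) q j
           else q w.

Definition error_poly (F : nzRingType) S s : V -> {poly F} :=
  foldl (@error_poly_step F) (fun k => if k \in S then 1 else 0) s.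

End ZeroForcing.

Arguments error_poly {V} e F S s _.

Section ErrorPolyEquations.
Variables (V : finType) (e : rel V) (F : nzRingType).
Implicit Types (C S : {set V}) (s : seq (V * V)) (q : V -> {poly F}).

Lemma can_force_notin C u v : can_force e C u v -> v \notin C.
Proof.
by case/andP=> _ /eqP/setP/(_ v); rewrite !inE eqxx => /andP[].
Qed.

Lemma can_force_sub C u v : can_force e C u v ->
  closed_nbhd e u :\ v \subset C.
Proof.
case/andP=> uC /eqP/setP E; apply/subsetP=> w; rewrite !inE => /andP[wv].
case/orP=> [/eqP->//|euw]; move: (E w); rewrite !inE euw (negbTE wv) /=.
by move/negbFE.
Qed.

Lemma error_poly_stable C s q w : valid_forces e C s -> w \in C ->
  foldl (@error_poly_step _ e F) q s w = q w.
Proof.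
elim: s C q => [|[u v] s IH] //= C q /andP[fuv /IH{}IH] wC.
rewrite IH ?inE ?wC ?orbT // /error_poly_step /=.
by case: eqP wC => [->|//]; rewrite (negbTE (can_force_notin fuv)).
Qed.

Lemma error_poly_in S s k : valid_forces e S s -> k \in S ->
  error_poly e F S s k = 1.
Proof. by move=> vs kS; rewrite /error_poly (error_poly_stable _ vs) ?kS. Qed.

Lemma error_poly_force S s i k : valid_forces e S s -> (i, k) \in s ->
  error_poly e F S s k =
  'X * \sum_(j in closed_nbhd e i :\ k) error_poly e F S s j.
Proof.
rewrite /error_poly; set q := (X in foldl _ X); move: q.
elim: s S => [|[u v] s IH] //= C q /andP[fuv vs]; rewrite inE.
case/orP=> [/eqP[-> ->]|]; last exact: (IH _ _ vs).
rewrite (error_poly_stable _ vs) ?setU11 // {1}/error_poly_step /= eqxx.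
congr (_ * _); apply: eq_bigr => j jN.
have jC := subsetP (can_force_sub fuv) _ jN.
rewrite (error_poly_stable _ vs) ?setU1r // /error_poly_step /=.
by case: eqP jN => // ->; rewrite !inE eqxx.
Qed.

End ErrorPolyEquations.

Section MatricesOfGraphs.
Variable V : finType.

(* Entries of #|V|-dimensional matrices and vectors, indexed by V. *)
Definition mx_at (F : Type) (A : 'M[F]_#|V|) (i j : V) : F :=
  A (enum_rank i) (enum_rank j).

Definition vec_at (F : Type) (x : 'cV[F]_#|V|) (i : V) : F :=
  x (enum_rank i) ord0.

Definition graph_matrix (F : nzRingType) (e : rel V) (A : 'M[F]_#|V|) : Prop :=
  forall i j : V, i != j ->
    (~~ e i j -> mx_at A i j = 0) /\ (e i j -> mx_at A i j != 0).

Definition subvector (F : Type) (S : {set V}) (x : 'cV[F]_#|V|) :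
    {ffun {i : V | i \in S} -> F} :=
  [ffun i => vec_at x (val i)].

End MatricesOfGraphs.

(* The default 1 is the value on the zero matrix; it does not affect the maximum
   otherwise, since triples (i, j, j) already contribute 1. All the quantities
   compared are norms, so this is a genuine maximum for complex F as well. *)
Definition kappa' (F : numFieldType) (n : nat) (A : 'M[F]_n) : F :=
  \big[Num.max/1]_i \big[Num.max/1]_(j | A i j != 0)
    \big[Num.max/1]_(k | A i k != 0) `|A i j / A i k|.

(* Main.v *)
Require Import Defs.
From HB Require Import structures.
From mathcomp Require Import all_boot all_order all_algebra.
From mathcomp Require Import complex.
From mathcomp Require Import reals matrix_normedtype.
From mathcomp Require Import interval_inference.
Set Implicit Arguments.
Unset Strict Implicit.
Unset Printing Implicit Defensive.
Import Order.TTheory GRing.Theory Num.Theory.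
Local Open Scope ring_scope.

(** If [u] forces [v], the row of [A] at [u] determines [x v] as a linear
    combination of the entries of a kernel vector [x] on [N[u] \ {v}], with
    coefficients [- A u j / A u v] of modulus at most [kappa' A]. The
    reconstruction [Phi] solves these equations along the chain, so the
    errors satisfy the recursion of the error polynomials at [kappa' A], with
    an inequality in place of the equality. *)

(** The order of [F] may be partial, as on complex numbers; realness makes all the values
    comparable, so that [Num.max] is an actual maximum. *)
Lemma real_le_bigmax (F : numDomainType) (I : eqType) (x0 : F) (r : seq I)
    (P : pred I) (f : I -> F) i :
  x0 \is Num.real -> (forall j, f j \is Num.real) -> i \in r -> P i ->
  f i <= \big[Num.max/x0]_(j <- r | P j) f j.
Proof.
move=> x0r fr; elim: r => //= j r IH; rewrite inE big_cons => /predU1P[<-|ir] Pi.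
  by rewrite Pi comparable_le_max ?lexx // real_comparable ?bigmax_real.
case: (P j); last exact: IH.
by rewrite comparable_le_max ?IH ?orbT // real_comparable ?bigmax_real.
Qed.

Lemma norm_div_le_kappa' (F : numFieldType) n (A : 'M[F]_n) i j k :
  A i k != 0 -> `|A i j / A i k| <= kappa' A.
Proof.
have row_real l l' : \big[Num.max/1]_(k | A l k != 0) `|A l l' / A l k|
    \is Num.real by rewrite bigmax_real.
have mat_real l : \big[Num.max/1]_(j | A l j != 0)
    \big[Num.max/1]_(k | A l k != 0) `|A l j / A l k| \is Num.real.
  by rewrite bigmax_real.
move=> ik0.
have bound l : A i l != 0 -> `|A i l / A i k| <= kappa' A.
  move=> il0; apply: le_trans (real_le_bigmax _ mat_real (mem_index_enum i) _) => //.
  apply: le_trans (real_le_bigmax _ (row_real i) (mem_index_enum l) il0) => //.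
  exact: (real_le_bigmax (f := fun k => `|A i l / A i k|) _ _ (mem_index_enum k)).
(* A zero entry [A i j] is left out of the maximum; the quotient is then 0, and [bound] at [k] shows
   that [kappa' A] is nonnegative. *)
have [->|/bound//] := eqVneq (A i j) 0.
by rewrite mul0r normr0; apply: le_trans (bound k ik0).
Qed.

Lemma coord_le_mx_norm (F : numDomainType) m n (x : 'M[F]_(m, n)) i j :
  `|x i j| <= mx_norm x.
Proof.
(* [mx_norm] is a maximum of nonnegative numbers, which are totally ordered even when [F] is not. *)
rewrite mx_normE -[leLHS]nngE num_le.
exact: (le_bigmax _ (fun ij => `|x ij.1 ij.2|%:nng) (i, j)).
Qed.

Lemma horner_error_poly_step (F : comNzRingType) (V : finType) (e : rel V)
    (q : V -> {poly F}) u v (t : F) :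
  (error_poly_step e q (u, v) v).[t] =
  t * \sum_(j in closed_nbhd e u :\ v) (q j).[t].
Proof. by rewrite /error_poly_step eqxx hornerM hornerX horner_sum. Qed.

Lemma can_force_edge (V : finType) (e : rel V) (C : {set V}) u v :
  can_force e C u v -> e u v.
Proof. by case/andP=> _ /eqP/setP/(_ v); rewrite !inE eqxx => /andP[]. Qed.

Section Reconstruction.
Variables (F : numFieldType) (V : finType) (e : rel V) (A : 'M[F]_#|V|).
Hypotheses (e_irr : irreflexive e) (hA : graph_matrix e A).
Implicit Types (C S : {set V}) (s : seq (V * V)) (g : V -> F).

(** Mirrors [error_poly_step], so that the two folds along the chain can be compared force by
    force. *)
Definition solve_step g (f : V * V) : V -> F :=
  fun w => if w == f.2
    then - \sum_(j in closed_nbhd e f.1 :\ f.2)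
             mx_at A f.1 j / mx_at A f.1 f.2 * g j
    else g w.

Lemma can_force_neq0 C u v : can_force e C u v -> mx_at A u v != 0.
Proof.
move=> /can_force_edge euv; apply: (hA _).2 => //.
by apply: contraTneq euv => ->; rewrite e_irr.
Qed.

(** Row [u] of [A] vanishes outside [N[u]]; the arbitrary diagonal entry keeps [u] itself in the
    sum. *)
Lemma ker_row_nbhd (x : 'cV[F]_#|V|) u : A *m x = 0 ->
  \sum_(j in closed_nbhd e u) mx_at A u j * vec_at x j = 0.
Proof.
move=> /matrixP/(_ (enum_rank u) ord0); rewrite !mxE => Ax0.
rewrite -[RHS]Ax0 (reindex _ (onW_bij _ (@enum_rank_bij V))) /=.
rewrite [RHS](bigID (mem (closed_nbhd e u))) /= [X in _ + X]big1 ?addr0 // => j.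
rewrite !inE negb_or eq_sym => /andP[uj nuj].
by have /(_ nuj) := (hA uj).1; rewrite /mx_at => ->; rewrite mul0r.
Qed.

Lemma ker_solve (x : 'cV[F]_#|V|) C u v : A *m x = 0 -> can_force e C u v ->
  vec_at x v =
  - \sum_(j in closed_nbhd e u :\ v) mx_at A u j / mx_at A u v * vec_at x j.
Proof.
move=> Ax0 fuv; have uv0 := can_force_neq0 fuv; have euv := can_force_edge fuv.
have := ker_row_nbhd u Ax0; rewrite (big_setD1 v) /=; last first.
  by rewrite !inE euv orbT.
move/eqP; rewrite addr_eq0 => /eqP eq_v; apply: (mulfI uv0); rewrite eq_v.
rewrite mulrN mulr_sumr; congr (- _); apply: eq_bigr => j _.
by rewrite mulrA [mx_at A u v * _]mulrC divfK.
Qed.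

(** Each force targets a vertex not yet coloured, so a coloured entry is never overwritten. *)
Lemma foldl_solve_stable C s g w : valid_forces e C s -> w \in C ->
  foldl solve_step g s w = g w.
Proof.
elim: s C g => [|[u v] s IH] //= C g /andP[fuv /IH{}IH] wC.
rewrite IH ?inE ?wC ?orbT // /solve_step /=.
by case: eqP wC => [->|//]; rewrite (negbTE (can_force_notin fuv)).
Qed.

(** The error bound on the coloured set is an invariant of the forcing process; arbitrary [C], [g]
    and [q] let the induction pass to the state after the first force. *)
Lemma foldl_solve_error (x : 'cV[F]_#|V|) (eps : F) C s g (q : V -> {poly F}) :
    A *m x = 0 -> valid_forces e C s ->
    {in C, forall w, `|vec_at x w - g w| <= (q w).[kappa' A] * eps} ->
  {in C :|: [set v in unzip2 s], forall w,
    `|vec_at x w - foldl solve_step g s w|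
      <= (foldl (@error_poly_step _ e F) q s w).[kappa' A] * eps}.
Proof.
move=> Ax0; elim: s C g q => [|[u v] s IH] /= C g q.
  by move=> _ Cq w; rewrite !inE orbF; apply: Cq.
case/andP=> fuv vs Cq w w_in.
apply: (IH (v |: C)) => // [{w_in}w|]; last first.
  by move: w_in; rewrite !inE orbCA orbA.
rewrite in_setU1; have [-> _|wv /= wC] := eqVneq w v; last first.
  by rewrite /solve_step /error_poly_step /= (negbTE wv); apply: Cq.
rewrite horner_error_poly_step /solve_step /= eqxx (ker_solve Ax0 fuv).
rewrite -opprD normrN -sumrB -mulrA mulr_suml mulr_sumr.
apply: le_trans (ler_norm_sum _ _ _) _; apply: ler_sum => j jN.
rewrite -mulrBr normrM ler_pM //.
  by apply: norm_div_le_kappa'; exact: can_force_neq0 fuv.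
(* The members of [N[u]] other than [v] are already coloured, so the invariant bounds their
   errors. *)
exact/Cq/(subsetP (can_force_sub fuv)).
Qed.

End Reconstruction.

(** The value 0 off [S] is a placeholder: a valid chain reads only entries already coloured. *)
Definition extend_by0 (F : nmodType) (V : finType) (S : {set V})
    (y : {ffun {i : V | i \in S} -> F}) (w : V) : F :=
  if insub w is Some i then y i else 0.

Lemma extend_by0_subvector (F : nmodType) (V : finType) (S : {set V})
    (x : 'cV[F]_#|V|) w :
  w \in S -> extend_by0 (subvector S x) w = vec_at x w.
Proof. by move=> wS; rewrite /extend_by0 insubT ffunE. Qed.

Theorem theorem2 (R : realType) (F : numFieldType)
  (hF : F = (R : numFieldType) \/ F = (R[i]%C : numFieldType))
  (V : finType) (e : rel V) (e_sym : symmetric e) (e_irr : irreflexive e)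
  (S : {set V}) (hS : zero_forcing_set e S)
  (S' : seq (V * V)) (hS' : forcing_chain e S S')
  (A : 'M[F]_#|V|) (hA : graph_matrix e A) :
  exists Phi : {ffun {i : V | i \in S} -> F} -> 'cV[F]_#|V|,
    forall eps : F, 0 < eps ->
    forall x : 'cV[F]_#|V|, A *m x = 0 ->
    forall x' : 'cV[F]_#|V|, mx_norm (x - x') < eps ->
      subvector S (Phi (subvector S x')) = subvector S x' /\
      forall i : V,
        `|vec_at x i - vec_at (Phi (subvector S x')) i|
          <= (error_poly e F S S' i).[kappa' A] * eps.
Proof.
have [vS' onceS'] := hS'.
exists (fun y => \col_i foldl (solve_step e A) (extend_by0 y) S' (enum_val i)).
move=> eps _ x Ax0 x' xx'; split=> [|i].
  apply/ffunP=> i; rewrite !ffunE /vec_at mxE enum_rankK.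
  by rewrite (foldl_solve_stable _ _ vS') ?(valP i) // extend_by0_subvector ?(valP i).
rewrite {2}/vec_at mxE enum_rankK.
apply: (foldl_solve_error e_irr hA Ax0 vS') => [w wS|].
  (* On [S] the starting polynomial is 1, so the bound to prove is [eps] itself. *)
  rewrite wS hornerC mul1r extend_by0_subvector //.
  apply: le_trans (ltW xx').
  by have := coord_le_mx_norm (x - x') (enum_rank w) ord0; rewrite !mxE.
(* Being forced exactly once puts every vertex outside [S] among the targets of the chain. *)
rewrite !inE; have [//|/onceS' cnt] := boolP (i \in S).
by rewrite -has_pred1 has_count cnt.
Qed.
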